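(* Let $C\subseteq\mathbb{R}^n$ be a closed convex cone with statistical dimension $\delta(C)$. Then for every $A\in\mathbb{R}^{p\times n}$, $$\delta(AC)\le \mathcal{R}_C(A)^2\cdot\delta(C),$$ where $\mathcal{R}_C(A)$ is Renegar's condition number of $A$ with respect to $C$. If moreover $p\ge n$ and $A$ has full rank, then, with $\kappa(A)$ the matrix condition number of $A$, $$\frac{\delta(C)}{\kappa(A)^2}\le\delta(AC)\le\kappa(A)^2\cdot\delta(C).$$
   Context: $\|\cdot\|$ is the Euclidean norm on vectors and the operator norm on matrices, and $S^{k-1}$ is the unit sphere of $\mathbb{R}^k$. For a closed convex cone $K\subseteq\mathbb{R}^k$, $\Pi_K$ is the Euclidean projection onto $K$, and the statistical dimension is $\delta(K)=\mathbb{E}[\|\Pi_K(g)\|^2]$ with $g$ a standard Gaussian vector in $\mathbb{R}^k$. For a convex cone that is not closed, $\delta$ means the statistical dimension of its closure. $AC=\{Ax: x\in C\}$. For $A\in\mathbb{R}^{p\times n}$ put $\sigma(A)=\min_{x\in S^{n-1}}\|Ax\|$ and $\kappa(A)=\min\{\|A\|/\sigma(A),\ \|A\|/\sigma(A^T)\}$. Renegar's condition number of $A\in\mathbb{R}^{p\times n}$ with respect to a closed convex cone $C\subseteq\mathbb{R}^n$ is $$\mathcal{R}_C(A)=\min\left\{\frac{\|A\|}{\sigma_C(A)},\ \frac{\|A\|}{\sigma_{\mathbb{R}^p\to C}(-A^T)}\right\},$$ where $\sigma_C(A)=\min_{x\in C\cap S^{n-1}}\|Ax\|$ and $\sigma_{\mathbb{R}^p\to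 C}(-A^T)=\min_{y\in S^{p-1}}\|\Pi_C(-A^Ty)\|$. Conventions: a quotient with zero denominator is $+\infty$; a minimum over the empty set (case $C=\{0\}$) is $+\infty$ and the corresponding quotient is $0$. *)

(* Defs.v *)
From HB Require Import structures.
From mathcomp Require Import all_boot all_order all_algebra.
From mathcomp Require Import all_classical all_reals all_analysis.

Set Implicit Arguments.
Unset Strict Implicit.
Unset Printing Implicit Defensive.

Import Order.TTheory GRing.Theory Num.Theory.
Import numFieldNormedType.Exports.

Local Open Scope classical_set_scope.
Local Open Scope ring_scope.

(* The library's norm on matrices is the sup-norm; the topology of 'cV[R]_k
   (used by [closed] and [closure]) is the usual one either way. *)
Definition enorm (R : realType) (k : nat) (x : 'cV[R]_k) : R :=
  Num.sqrt (\sum_(i < k) x i ord0 ^+ 2).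

Definition usphere (R : realType) (k : nat) : set 'cV[R]_k :=
  [set x | enorm x = 1].
Arguments usphere : clear implicits.

(* Taken over the unit ball rather than the sphere, so that it is 0, not -oo,
   when n = 0. *)
Definition opnorm (R : realType) (p n : nat) (A : 'M[R]_(p, n)) : \bar R :=
  ereal_sup [set (enorm (A *m x))%:E | x in [set x : 'cV[R]_n | enorm x <= 1]].

Definition closed_convex_cone (R : realType) (n : nat) (C : set 'cV[R]_n) :=
  [/\ closed C, C !=set0, convex_set C
    & forall (a : R) (x : 'cV[R]_n), 0 <= a -> C x -> C (a *: x)].

(* The nearest point; it exists and is unique when K is a nonempty closed
   convex set. *)
Definition proj (R : realType) (k : nat) (K : set 'cV[R]_k) (x : 'cV[R]_k) :
    'cV[R]_k :=
  xget 0 [set y | K y /\ forall z, K z -> enorm (x - y) <= enorm (x - z)].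

Section gaussian.
Variable R : realType.

Definition cons_pair (k : nat)
    (u : measurableTypeR R * k.-tuple (measurableTypeR R)) :
    k.+1.-tuple (measurableTypeR R) :=
  [the k.+1.-tuple _ of u.1 :: u.2].

Lemma measurable_cons_pair (k : nat) :
  measurable_fun [set: measurableTypeR R * k.-tuple (measurableTypeR R)]
    (@cons_pair k).
Proof. exact: measurable_cons. Qed.

HB.instance Definition _ (k : nat) :=
  isMeasurableFun.Build _ _ _ _ (@cons_pair k) (@measurable_cons_pair k).

(* The law of k independent N(0, 1) coordinates: the k-fold product of
   [normal_prob 0 1], transported to k-tuples. *)
Fixpoint std_gaussian (k : nat) :
    probability (k.-tuple (measurableTypeR R)) R :=
  match k with
  | 0 => \d_ [tuple]
  | k'.+1 => distribution (normal_prob 0 1 \x std_gaussian k')%E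
               (@cons_pair k')
  end.

End gaussian.

(* E ||Pi_K(g)||^2, with the closure of K in place of K: this is the usual
   definition when K is closed, and the convention when it is not. *)
Definition statdim (R : realType) (k : nat) (K : set 'cV[R]_k) : \bar R :=
  'E_(std_gaussian R k)
    [fun g => enorm (proj (closure K) (\col_(i < k) tnth g i)) ^+ 2].

(* An infimum over the empty set is +oo, and r / +oo = 0 for r finite. *)
Definition sigma (R : realType) (p n : nat) (A : 'M[R]_(p, n)) : \bar R :=
  ereal_inf [set (enorm (A *m x))%:E | x in usphere R n].

Definition sigma_cone (R : realType) (p n : nat) (C : set 'cV[R]_n)
    (A : 'M[R]_(p, n)) : \bar R :=
  ereal_inf [set (enorm (A *m x))%:E | x in C `&` usphere R n].

(* [sigma_to_cone C B] is the quantity sigma_{R^p -> C}(B), to be used with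
   B = - A^T. *)
Definition sigma_to_cone (R : realType) (p n : nat) (C : set 'cV[R]_n)
    (B : 'M[R]_(n, p)) : \bar R :=
  ereal_inf [set (enorm (proj C (B *m y)))%:E | y in usphere R p].

(* For a >= 0 this differs from the library's division only on 0 / 0, which is
   +oo here. *)
Definition quot (R : realType) (a b : \bar R) : \bar R :=
  if b == 0%E then +oo%E else (a / b)%E.

Definition kappa (R : realType) (p n : nat) (A : 'M[R]_(p, n)) : \bar R :=
  Order.min (quot (opnorm A) (sigma A)) (quot (opnorm A) (sigma A^T)).

Definition renegar (R : realType) (p n : nat) (C : set 'cV[R]_n)
    (A : 'M[R]_(p, n)) : \bar R :=
  Order.min (quot (opnorm A) (sigma_cone C A))
            (quot (opnorm A) (sigma_to_cone C (- A^T))).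

(* Main.v *)
From Pilot Require Import Defs.
From mathcomp Require Import all_boot all_order all_algebra.
From mathcomp Require Import ring lra.
From mathcomp Require Import all_classical all_reals all_analysis.
From mathcomp Require Import measurable_realfun.
(* proj is the nearest point below, not a coordinate projection. *)
Import Pilot.Defs.

(** The squared norm of the projection of g onto a closed convex cone K is a convex
    function of g, because the norm of the projection is the support function
    sup { dot g z | z in K, |z| <= 1 } (dot_le_proj_norm, proj_norm_le).  Two facts
    give the theorem.

    - Pointwise comparison.  If |A x| >= s |x| on C, or if for all y the projection
      of -A^T y onto C has norm at least s |y|, then the projection of any g onto
      the closure of A C is at most 1 / s times as long as the projection of A^T g
      onto C (proj_image_le_sigma, proj_image_le_sigma_to).
    - Gaussian comparison.  If |M^T y| <= L |y| for all y, the covariance of M g is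
      at most L^2 times the identity, and the expectation of a convex function of a
      centred Gaussian vector increases with the covariance, by Jensen's inequality.
      Hence the expected squared norm of the projection of M g onto K is at most
      L^2 times the statistical dimension of K (integral_sqproj_mulmx_le).

    With M = A^T and L = |A| they bound the statistical dimension of A C by
    (|A| / s)^2 times that of C, for each of the two constants s in the definition
    of the condition numbers.  For the lower bound the same argument is applied to
    A C and a left inverse B of A with |B| <= 1 / s, which maps A C back onto C
    (statdim_le_image).  The constants of kappa reduce to these by kappaP.  An
    infinite condition number requires in addition that the statistical dimension
    of a nontrivial cone is positive (statdim_gt0).

    The Gaussian comparison avoids the density of a general Gaussian vector.
    Integrating g a along one vector a is an operator on functions, gauss_op a, and
    the law of a linear image is a composition of such operators.  The rotation
    invariance of the plane Gaussian measure (normal_plane_rot) allows two vectors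
    of the list to be rotated (gauss_op_rot), and Jensen's inequality allows a
    vector to be added; these two moves turn the columns of M, one coordinate at a
    time, into an orthonormal basis (gauss_ops_dominated). *)

Set Implicit Arguments.
Unset Strict Implicit.
Unset Printing Implicit Defensive.

Import Order.TTheory GRing.Theory Num.Theory.
Import numFieldNormedType.Exports.

Local Open Scope classical_set_scope.
Local Open Scope ring_scope.

(** * Rotation invariance of the Gaussian measure on the plane *)

Section gaussian_plane.
Context {R : realType}.
Local Open Scope ereal_scope.
Local Notation mu := (@lebesgue_measure R).
Local Notation gamma := (@normal_prob R 0 1).
Local Notation RR := (measurableTypeR R).
Local Notation phi := (@normal_pdf R 0 1).

(** The density and the Radon-Nikodym derivative of the normal law have the same
    integral over every measurable set, hence agree almost everywhere; the change
    of variables known for the derivative therefore holds for the density. *)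
Lemma ge0_integral_normal_prob (f : RR -> \bar R) :
  measurable_fun setT f -> (forall x, 0 <= f x) ->
  \int[gamma]_x f x = \int[mu]_x (f x * (phi x)%:E).
Proof.
move=> mf f0.
have dom := @normal_prob_dominates R 0 1.
rewrite -(Radon_Nikodym_SigmaFinite.change_of_variables dom f0 measurableT mf).
have mphi : measurable_fun setT (fun x : RR => (phi x)%:E).
  by apply/measurable_EFinP; exact: measurable_normal_pdf.
have iF := Radon_Nikodym_SigmaFinite.f_integrable dom.
have mF := measurable_int _ iF.
apply: ae_eq_integral => //.
- exact: emeasurable_funM.
- exact: emeasurable_funM.
- apply: ae_eqe_mul2l; apply: integral_ae_eq => //.
  move=> A _ mA; rewrite -Radon_Nikodym_SigmaFinite.f_integral//.
Qed.

Lemma ge0_integral_lebesgue_shift (a : R) (f : RR -> \bar R) :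
  measurable_fun setT f -> (forall x, 0 <= f x) ->
  \int[mu]_x f (x + a)%R = \int[mu]_x f x.
Proof.
move=> mf f0.
have mD : measurable_fun setT (fun x : RR => (x + a)%R : RR).
  exact: measurable_funD.
rewrite -[LHS](ge0_integral_pushforward mD mu measurableT mf)//.
apply: eq_measure_integral => A mA _.
apply/esym; apply: (@lebesgue_measure_unique R
  (pushforward mu (fun x : RR => (x + a)%R : RR))) => //.
move=> _ [[x y] _ <-] /=; rewrite /pushforward.
have -> : (fun z : R => (z + a)%R) @^-1` `]x, y]%classic =
    `](x - a)%R, (y - a)%R]%classic.
  by apply/seteqP; split => z /=; rewrite !in_itv/= ltrBlDr lerBrDr.
rewrite !lebesgue_measure_itv/= !lte_fin ltrD2r.
by case: ifP => // _; congr EFin; ring.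
Qed.

Lemma normal_pdf_std (x : R) : phi x = (normal_peak 1 * expR (- x ^+ 2 / 2))%R.
Proof.
by rewrite (normal_pdfE _ (oner_neq0 R)) /normal_fun subr0 expr1n.
Qed.

Lemma normal_pdf_rot (c d s t : R) : (c ^+ 2 + d ^+ 2 = 1)%R ->
  (phi (c * s - d * t) * phi (d * s + c * t) = phi s * phi t)%R.
Proof.
move=> cd; rewrite !normal_pdf_std.
suff E : (expR (- (c * s - d * t) ^+ 2 / 2) * expR (- (d * s + c * t) ^+ 2 / 2)
  = expR (- s ^+ 2 / 2) * expR (- t ^+ 2 / 2))%R.
  by rewrite mulrACA E mulrACA.
rewrite -!expRD; congr expR.
transitivity (- ((c ^+ 2 + d ^+ 2) * (s ^+ 2 + t ^+ 2)) / 2)%R; first by field.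
by rewrite cd; field.
Qed.

Definition plane_int (G : R -> R -> \bar R) := \int[mu]_s \int[mu]_t G s t.

Definition measurable2 (G : R -> R -> \bar R) :=
  measurable_fun [set: RR * RR] (fun z : RR * RR => G z.1 z.2).

Lemma measurable2_comp (G : R -> R -> \bar R) (a b c d : R) : measurable2 G ->
  measurable2 (fun s t => G (a * s + b * t)%R (c * s + d * t)%R).
Proof.
move=> mG; rewrite /measurable2.
have mL (x y : R) : measurable_fun [set: RR * RR]
    (fun z : RR * RR => (x * z.1 + y * z.2)%R : RR).
  by apply: measurable_funD; apply: measurable_funM.
by have := measurableT_comp mG (measurable_fun_pair (mL a b) (mL c d)).
Qed.

Lemma plane_int_swap (G : R -> R -> \bar R) : measurable2 G -> (forall s t, 0 <= G s t) ->
  plane_int G = plane_int (fun s t => G t s).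
Proof.
move=> mG G0; rewrite /plane_int.
by rewrite (fubini_tonelli (fun z : RR * RR => G z.1 z.2)).
Qed.

Lemma plane_int_shear_right (G : R -> R -> \bar R) (b : R) :
  measurable2 G -> (forall s t, 0 <= G s t) ->
  plane_int (fun s t => G s (t + b * s)%R) = plane_int G.
Proof.
move=> mG G0; apply: eq_integral => s _.
rewrite (ge0_integral_lebesgue_shift (b * s)%R (f := G s))//.
exact: (measurableT_comp mG (measurable_pair1 s)).
Qed.

Lemma plane_int_shear_left (G : R -> R -> \bar R) (b : R) :
  measurable2 G -> (forall s t, 0 <= G s t) ->
  plane_int (fun s t => G (s + b * t)%R t) = plane_int G.
Proof.
move=> mG G0.
have m1 : measurable2 (fun s t => G (s + b * t)%R t).
  have := measurable2_comp 1 b 0 1 mG; congr measurable2.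
  by apply/funext => s; apply/funext => t; congr G; ring.
have m2 : measurable2 (fun s t => G t s).
  have := measurable2_comp 0 1 1 0 mG; congr measurable2.
  by apply/funext => s; apply/funext => t; congr G; ring.
rewrite (plane_int_swap m1); last by move=> *; exact: G0.
rewrite (plane_int_shear_right (G := fun s t => G t s) b m2); last by move=> *; exact: G0.
exact/esym/plane_int_swap.
Qed.

(** A rotation of angle other than 0 and pi is the product of three shears
    parallel to the axes, and a shear preserves the iterated Lebesgue integral
    because, once one coordinate is fixed, it is a translation of the other.  The
    half turn is the square of a quarter turn. *)
Lemma plane_int_rot (G : R -> R -> \bar R) (c d : R) :
  measurable2 G -> (forall s t, 0 <= G s t) -> (c ^+ 2 + d ^+ 2 = 1)%R ->
  plane_int (fun s t => G (c * s - d * t) (d * s + c * t))%R = plane_int G.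
Proof.
move=> + + cd.
have main G' c' d' : measurable2 G' -> (forall s t, 0 <= G' s t) -> d' != 0%R ->
    (c' ^+ 2 + d' ^+ 2 = 1)%R ->
    plane_int (fun s t => G' (c' * s - d' * t) (d' * s + c' * t))%R = plane_int G'.
  move=> mG G0 d0 cd'.
  (* the three shears are s += a t, then t += d' s, then s += a t *)
  pose a := ((c' - 1) / d')%R.
  pose G1 s t := G' (s + a * t)%R t.
  pose G2 s t := G1 s (t + d' * s)%R.
  have m1 : measurable2 G1.
    have := measurable2_comp 1 a 0 1 mG; congr measurable2.
    by apply/funext => s; apply/funext => t; rewrite /G1 !mul1r mul0r add0r.
  have m2 : measurable2 G2.
    have := measurable2_comp 1 0 d' 1 m1; congr measurable2.
    by apply/funext => s; apply/funext => t; rewrite /G2 !mul1r mul0r addr0 addrC.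
  transitivity (plane_int (fun s t => G2 (s + a * t)%R t)).
    congr plane_int; apply/funext => s; apply/funext => t.
    rewrite /G2 /G1; congr G'; last by rewrite /a; field.
    have -> : (c' * s - d' * t = c' * s - ((c' ^+ 2 + d' ^+ 2) - c' ^+ 2) / d' * t)%R.
      by field.
    by rewrite cd' /a; field.
  rewrite (plane_int_shear_left a m2); last by move=> *; exact: G0.
  rewrite (plane_int_shear_right d' m1); last by move=> *; exact: G0.
  exact: plane_int_shear_left.
move=> mG G0; have [d0|d0] := eqVneq d 0%R; last exact: main.
have /orP[/eqP c1|/eqP c1] : (c == 1%R) || (c == (-1)%R).
  by rewrite -sqrf_eq1 -cd d0 expr0n addr0.
  by congr plane_int; apply/funext => s; apply/funext => t; congr G; rewrite c1 d0; ring.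
have r2 : (0 ^+ 2 + 1 ^+ 2 = 1 :> R)%R by ring.
pose G1 s t := G (0 * s - 1 * t)%R (1 * s + 0 * t)%R.
have m1 : measurable2 G1.
  have := measurable2_comp 0 (-1) 1 0 mG; congr measurable2.
  by apply/funext => s; apply/funext => t; rewrite /G1 mulN1r !mul1r.
rewrite -(main _ _ _ mG G0 (oner_neq0 R) r2) -/G1.
rewrite -(main _ _ _ m1 _ (oner_neq0 R) r2); last by move=> *; exact: G0.
congr plane_int; apply/funext => s; apply/funext => t; rewrite /G1 c1 d0.
by congr G; ring.
Qed.

(** The product of two standard normal densities depends on s^2 + t^2 only, so
    it can be moved through the rotation of the Lebesgue integral. *)
Lemma normal_plane_rot (G : R -> R -> \bar R) (c d : R) :
  measurable2 G -> (forall s t, 0 <= G s t) -> (c ^+ 2 + d ^+ 2 = 1)%R ->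
  \int[gamma]_s \int[gamma]_t G (c * s - d * t)%R (d * s + c * t)%R =
  \int[gamma]_s \int[gamma]_t G s t.
Proof.
move=> mG G0 cd.
have plane H : measurable2 H -> (forall s t, 0 <= H s t) ->
    \int[gamma]_s \int[gamma]_t H s t =
    plane_int (fun s t => H s t * (phi s * phi t)%:E).
  move=> mH H0.
  have mH1 s : measurable_fun [set: RR] (H s).
    exact: (measurableT_comp mH (measurable_pair1 s)).
  rewrite ge0_integral_normal_prob//; first last.
  - by move=> s; apply: integral_ge0.
  - exact: (measurable_fun_fubini_tonelli_F (m2 := gamma) (fun z : RR * RR => H z.1 z.2)).
  apply: eq_integral => s _.
  rewrite ge0_integral_normal_prob// -ge0_integralZr//; first last.
  - by rewrite lee_fin normal_pdf_ge0.
  - by move=> t _; rewrite mule_ge0// lee_fin normal_pdf_ge0.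
  - apply: emeasurable_funM => //.
    by apply/measurable_EFinP; exact: measurable_normal_pdf.
  by apply: eq_integral => t _; rewrite -muleA -EFinM mulrC.
have mR := measurable2_comp c (- d) d c mG.
rewrite plane//; last first.
  by move: mR; congr measurable2; apply/funext => s; apply/funext => t; rewrite mulNr.
rewrite (plane G mG G0).
pose H s t := G s t * (phi s * phi t)%:E.
have mH : measurable2 H.
  apply: emeasurable_funM; first exact: mG.
  apply/measurable_EFinP; apply: measurable_funM.
  + exact: (measurableT_comp (measurable_normal_pdf 0 1)).
  + exact: (measurableT_comp (measurable_normal_pdf 0 1)).
have H0 s t : 0 <= H s t by rewrite mule_ge0// lee_fin mulr_ge0 ?normal_pdf_ge0.
rewrite -[RHS](plane_int_rot mH H0 cd).
by congr plane_int; apply/funext => s; apply/funext => t; rewrite /H normal_pdf_rot.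
Qed.

End gaussian_plane.

(** * Inner products and quadratic forms *)

Section dot.
Context {R : realType} {k : nat}.
Implicit Types (x y z : 'cV[R]_k) (a : R).

Definition dot x y : R := \sum_i x i ord0 * y i ord0.

Lemma dotC x y : dot x y = dot y x.
Proof. by apply: eq_bigr => i _; rewrite mulrC. Qed.

Lemma dotDl x y z : dot (x + y) z = dot x z + dot y z.
Proof. by rewrite -big_split; apply: eq_bigr => i _; rewrite mxE mulrDl. Qed.

Lemma dotZl a x y : dot (a *: x) y = a * dot x y.
Proof. by rewrite mulr_sumr; apply: eq_bigr => i _; rewrite mxE mulrA. Qed.

Lemma dotDr x y z : dot x (y + z) = dot x y + dot x z.
Proof. by rewrite dotC dotDl !(dotC x). Qed.

Lemma dotZr a x y : dot x (a *: y) = a * dot x y.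
Proof. by rewrite dotC dotZl dotC. Qed.

Lemma dotNl x y : dot (- x) y = - dot x y.
Proof. by rewrite -scaleN1r dotZl mulN1r. Qed.

Lemma dotNr x y : dot x (- y) = - dot x y.
Proof. by rewrite dotC dotNl dotC. Qed.

Lemma dotBl x y z : dot (x - y) z = dot x z - dot y z.
Proof. by rewrite dotDl dotNl. Qed.

Lemma dotBr x y z : dot x (y - z) = dot x y - dot x z.
Proof. by rewrite dotDr dotNr. Qed.

Lemma dot0l y : dot 0 y = 0.
Proof. by rewrite -(scale0r y) dotZl mul0r. Qed.

Lemma dot0r x : dot x 0 = 0. Proof. by rewrite dotC dot0l. Qed.

Lemma dot_ge0 x : 0 <= dot x x.
Proof. by apply: sumr_ge0 => i _; rewrite -expr2 sqr_ge0. Qed.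

Lemma dot_eq0 x : dot x x = 0 -> x = 0.
Proof.
move=> /eqP; rewrite psumr_eq0 => [/allP x0|i _]; last by rewrite -expr2 sqr_ge0.
apply/colP => i; have := x0 i (mem_index_enum i).
by rewrite /= mulf_eq0 orbb mxE => /eqP.
Qed.

(** The quadratic form of the covariance of sum_a g_a a, for independent
    standard normal g_a and a ranging over s. *)
Definition qform (s : seq 'cV[R]_k) y : R := \sum_(a <- s) dot a y ^+ 2.

Lemma qform_cons x s y : qform (x :: s) y = dot x y ^+ 2 + qform s y.
Proof. by rewrite /qform big_cons. Qed.

Fixpoint is_orthonormal (es : seq 'cV[R]_k) : Prop :=
  if es is e :: es' then
    [/\ dot e e = 1, (forall x, x \in es' -> dot x e = 0) & is_orthonormal es']
  else True.

(** Moving the argument along a direction orthogonal to the list is what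
    leaves one coordinate of the test vector free in the comparison of covariances. *)
Lemma qform_perp s e y (b : R) : (forall x, x \in s -> dot x e = 0) ->
  qform s (y + b *: e) = qform s y.
Proof.
by move=> se; apply: eq_big_seq => x /se xe; rewrite dotDr dotZr xe mulr0 addr0.
Qed.

End dot.

(** * Gaussian smoothing along a list of vectors *)

Section gauss_op.
Context {R : realType} {p : nat}.
Local Open Scope ereal_scope.
Local Notation V := 'cV[R]_p.
Local Notation gamma := (@normal_prob R 0 1).
Local Notation RR := (measurableTypeR R).
Implicit Types (F G : V -> \bar R) (a b e v : V).

Definition coord_measurable d (T : measurableType d) (phi : T -> V) :=
  forall i, measurable_fun [set: T] (fun t => phi t i ord0).

(** Borel measurability of F, expressed through the maps with measurable
    coordinates: these are stable under the affine changes of variables used below,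
    which makes the class stable under integration along a vector. *)
Definition borel F := forall d (T : measurableType d) (phi : T -> V),
  coord_measurable phi -> measurable_fun [set: T] (F \o phi).

Definition midconvex F := forall v h, F v + F v <= F (v + h)%R + F (v - h)%R.

(** The value at v of gauss_op a F is the expectation of F (v + g a) with g
    standard normal.  Expectations over Gaussian vectors are compositions of these
    operators, which reduces all computations to one or two variables. *)
Definition gauss_op a F : V -> \bar R := fun v => \int[gamma]_t F (v + t *: a)%R.

Definition borel_ge0 F := borel F /\ forall v, 0 <= F v.

Lemma measurable_gauss_line F a v : borel_ge0 F ->
  measurable_fun [set: RR] (fun t : RR => F (v + t *: a)%R).
Proof.
move=> [mF _]; apply: (mF _ _ (fun t : RR => v + t *: a)%R) => i.
rewrite [X in measurable_fun _ X](_ : _ = (fun t : R => v i ord0 + t * a i ord0)%R).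
  by apply: measurable_funD => //; exact: measurable_funM.
by apply/funext => t; rewrite !mxE.
Qed.

Lemma measurable2_gauss_plane F a b v : borel_ge0 F ->
  measurable2 (fun s t => F (v + s *: a + t *: b)%R).
Proof.
move=> [mF _]; apply: (mF _ _ (fun z : RR * RR => v + z.1 *: a + z.2 *: b)%R) => i.
rewrite [X in measurable_fun _ X](_ : _ =
    (fun z : RR * RR => v i ord0 + z.1 * a i ord0 + z.2 * b i ord0)%R).
  by apply: measurable_funD; [apply: measurable_funD => //|]; exact: measurable_funM.
by apply/funext => t; rewrite !mxE.
Qed.

(** Measurability of a parametrised integral, from Tonelli's theorem. *)
Lemma borel_ge0_gauss_op F a : borel_ge0 F -> borel_ge0 (gauss_op a F).
Proof.
move=> [mF F0]; split; last by move=> v; exact: integral_ge0.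
move=> d T phi mphi.
apply: (measurable_fun_fubini_tonelli_F (m2 := gamma)
  (fun z : T * RR => F (phi z.1 + z.2 *: a)%R)) => //.
apply: (mF _ _ (fun z : T * RR => phi z.1 + z.2 *: a)%R) => i.
rewrite [X in measurable_fun _ X](_ : _ =
    (fun z : T * RR => phi z.1 i ord0 + z.2 * a i ord0)%R).
  apply: measurable_funD; last exact: measurable_funM.
  exact: (measurableT_comp (mphi i) measurable_fst).
by apply/funext => t; rewrite !mxE.
Qed.

Lemma gauss_op_mono F G a : borel_ge0 F -> borel_ge0 G -> (forall v, F v <= G v) ->
  forall v, gauss_op a F v <= gauss_op a G v.
Proof.
move=> bF bG FG v; apply: ge0_le_integral => //.
- by move=> t _; case: bF.
- exact: measurable_gauss_line.
- exact: measurable_gauss_line.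
Qed.

Lemma integral_normal_prob_cst (r : \bar R) : \int[gamma]_t r = r.
Proof.
rewrite integral_cst//.
by rewrite -[RHS]mule1; congr (_ * _); exact: probability_setT.
Qed.

Lemma gauss_op0 F : gauss_op 0 F = F.
Proof.
apply/funext => v; rewrite /gauss_op.
under eq_integral do rewrite scaler0 addr0.
by rewrite integral_normal_prob_cst.
Qed.

(** For independent standard normal s and t, the vectors s a + t b and
    (c s - d t) a + (d s + c t) b have the same law. *)
Lemma gauss_op_rot F a b (c d : R) : borel_ge0 F -> (c ^+ 2 + d ^+ 2 = 1)%R ->
  gauss_op (c *: a + d *: b)%R (gauss_op (- d *: a + c *: b)%R F) =
  gauss_op a (gauss_op b F).
Proof.
move=> bF cd; apply/funext => v; have [_ F0] := bF.
rewrite -[RHS](normal_plane_rot (measurable2_gauss_plane a b v bF) (fun _ _ => F0 _) cd).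
apply: eq_integral => s _; apply: eq_integral => t _; congr F.
by apply/colP => i; rewrite !mxE; ring.
Qed.

(** The normal law is symmetric: this is the half turn of gauss_op_rot with the
    second vector equal to 0. *)
Lemma gauss_opN F a : borel_ge0 F -> gauss_op (- a) F = gauss_op a F.
Proof.
move=> bF; have cd : ((-1) ^+ 2 + 0 ^+ 2 = 1 :> R)%R by ring.
have := gauss_op_rot a 0 bF cd.
by rewrite !(scaleN1r, oppr0, scale0r, scaler0, addr0, gauss_op0).
Qed.

(** Jensen's inequality.  By symmetry twice the right-hand side is the expectation
    of F (v + g a) + F (v - g a), which is at least 2 F v. *)
Lemma midconvex_le_gauss_op F a : borel_ge0 F -> midconvex F ->
  forall v, F v <= gauss_op a F v.
Proof.
move=> bF cF v; have [_ F0] := bF.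
have : F v + F v <= gauss_op a F v + gauss_op a F v.
  rewrite -{2}(gauss_opN a bF) /gauss_op -ge0_integralD//; [|exact: measurable_gauss_line..].
  apply: (@le_trans _ _ (\int[gamma]_t (F v + F v))).
    by rewrite integral_normal_prob_cst.
  apply: ge0_le_integral => //.
  - by move=> t _; exact: adde_ge0.
  - by apply: emeasurable_funD; exact: measurable_gauss_line.
  - by move=> t _; rewrite scalerN; exact: cF.
by rewrite -!mule2n -!mule_natl lee_pmul2l// lte_fin.
Qed.

Lemma midconvex_gauss_op F a : borel_ge0 F -> midconvex F -> midconvex (gauss_op a F).
Proof.
move=> bF cF v h; have [_ F0] := bF; rewrite /gauss_op.
rewrite -!ge0_integralD//; try exact: measurable_gauss_line.
apply: ge0_le_integral => //.
- by move=> t _; exact: adde_ge0.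
- by apply: emeasurable_funD; exact: measurable_gauss_line.
- by apply: emeasurable_funD; exact: measurable_gauss_line.
- by move=> t _; rewrite (addrAC v h) (addrAC v (- h)%R); exact: cF.
Qed.

(** The basic step of the comparison: s e + t b has a smaller covariance than
    the independent sum of e and b.  The rotation of the pair e, b to
    s e + t b, - t e + s b turns the right-hand side into the smoothing of F along
    both of these vectors, and smoothing along the second one increases F. *)
Lemma gauss_op_le_split F e b (s t : R) : borel_ge0 F -> midconvex F ->
  (s ^+ 2 + t ^+ 2 = 1)%R ->
  forall v, gauss_op (s *: e + t *: b)%R F v <= gauss_op e (gauss_op b F) v.
Proof.
move=> bF cF st v; rewrite -(gauss_op_rot e b bF st).
apply: gauss_op_mono => //.
  exact: borel_ge0_gauss_op.
exact: midconvex_le_gauss_op.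
Qed.

Definition gauss_ops (s : seq V) F := foldr gauss_op F s.

Lemma borel_ge0_gauss_ops F s : borel_ge0 F -> borel_ge0 (gauss_ops s F).
Proof. by move=> bF; elim: s => //= a s; exact: borel_ge0_gauss_op. Qed.

Lemma midconvex_gauss_ops F s : borel_ge0 F -> midconvex F -> midconvex (gauss_ops s F).
Proof.
move=> bF cF; elim: s => //= a s; apply: midconvex_gauss_op.
exact: borel_ge0_gauss_ops.
Qed.

(** Rotating pairs of vectors of the list, as in an LQ factorisation by plane
    rotations, makes all of them but one orthogonal to e; neither the law nor the
    covariance changes. *)
Lemma gauss_ops_pivot F e s : borel_ge0 F -> exists a s',
  [/\ gauss_ops s F = gauss_ops (a :: s') F,
      (forall y, qform s y = qform (a :: s') y)
    & forall x, x \in s' -> dot x e = 0%R].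
Proof.
move=> bF; elim: s => [|x s [a [s' [E Q P]]]].
  exists 0%R, [::]; split => //=; first by rewrite gauss_op0.
  by move=> y; rewrite qform_cons dot0l expr0n add0r.
(* the angle that makes the rotated x orthogonal to e *)
have [c [d [cd pivot]]] : exists c d : R, (c ^+ 2 + d ^+ 2 = 1 /\
    - d * dot x e + c * dot a e = 0)%R.
  set u := dot x e; set w := dot a e.
  have [r0|r0] := eqVneq (u ^+ 2 + w ^+ 2)%R 0%R.
    exists 1%R, 0%R; split; first by ring.
    by nra.
  pose r := Num.sqrt (u ^+ 2 + w ^+ 2).
  have r2 : (r ^+ 2 = u ^+ 2 + w ^+ 2)%R by rewrite sqr_sqrtr// addr_ge0// sqr_ge0.
  have rn0 : (r != 0)%R by apply: contraNneq r0 => r0; rewrite -r2 r0 expr0n.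
  exists (u / r)%R, (w / r)%R; split; last by field.
  by rewrite !expr_div_n -mulrDl -r2 divff// sqrf_eq0.
exists (c *: x + d *: a)%R, ((- d *: x + c *: a)%R :: s'); split.
- by rewrite /= E /= gauss_op_rot//; exact: borel_ge0_gauss_ops.
- move=> y; rewrite !qform_cons Q qform_cons !addrA; congr (_ + _)%R.
  rewrite !dotDl !dotZl.
  transitivity ((c ^+ 2 + d ^+ 2) * (dot x y ^+ 2 + dot a y ^+ 2))%R.
    by rewrite cd mul1r.
  by ring.
- move=> z; rewrite inE => /predU1P[->|/P//].
  by rewrite dotDl !dotZl.
Qed.

(** The expectation of a convex function of a centred Gaussian vector increases
    with the covariance, here when the larger covariance is that of an orthonormal
    list es.  The induction removes one vector e of es at a time: after
    gauss_ops_pivot only the head a of the list has a component along e.  Then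
    a = g e + t b with g^2 + t^2 = 1 and b orthogonal to e, gauss_op_le_split
    replaces a by the pair e, b, and the covariance of b and of the rest of the
    list is still dominated by that of the rest of es. *)
Theorem gauss_ops_dominated F (es s : seq V) : borel_ge0 F -> midconvex F ->
  is_orthonormal es -> (forall y, qform s y <= qform es y)%R ->
  forall v, gauss_ops s F v <= gauss_ops es F v.
Proof.
move=> bF cF; elim: es s => [s _ Q v|e es IH s [ee ese oes] Q v].
  have s0 a : a \in s -> a = 0%R.
    move=> sa; apply: dot_eq0.
    have := Q a; rewrite {2}/qform big_nil => Qa.
    have : (dot a a ^+ 2 <= 0)%R.
      apply: le_trans Qa; rewrite /qform (big_rem a)//= lerDl.
      by apply: sumr_ge0 => b _; rewrite sqr_ge0.
    by nra.
  elim: s s0 {Q} => //= a s IH s0.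
  rewrite (s0 a) ?mem_head// gauss_op0; apply: IH => b bs.
  by apply: s0; rewrite inE bs orbT.
have [a [s' [-> {}Q' P]]] := gauss_ops_pivot e s bF.
have [g [w [aE we]]] : exists g w, a = (g *: e + w)%R /\ dot w e = 0%R.
  exists (dot a e), (a - dot a e *: e)%R; split; first by rewrite addrC subrK.
  by rewrite dotBl dotZl ee mulr1 subrr.
(* The component h of the test vector along e is free, since only the heads of
   the two lists depend on it. *)
have key y (h : R) : ((g * h + dot w y) ^+ 2 + qform s' y <= h ^+ 2 + qform es y)%R.
  have := Q (y + (h - dot e y) *: e)%R.
  rewrite Q' !qform_cons !qform_perp// aE !(dotDr, dotDl, dotZr, dotZl) ee we.
  by congr (_ ^+ 2 + _ <= _ ^+ 2 + _)%R; ring.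
have g1 : (g ^+ 2 <= 1)%R.
  have := key 0%R 1%R; rewrite dot0r /qform !big1 => [|? _|? _]; last 2 first.
  - by rewrite dot0r expr0n.
  - by rewrite dot0r expr0n.
  by rewrite mulr1 !addr0 expr1n.
have [b [t [gt wE Qb]]] : exists b (t : R), [/\ (g ^+ 2 + t ^+ 2 = 1)%R,
    w = (t *: b)%R & forall y, (qform (b :: s') y <= qform es y)%R].
  have [g2|g2] := eqVneq (g ^+ 2)%R 1%R.
    exists 0%R, 0%R; split; first by rewrite g2; ring.
    (* Here the inequality of key is affine in h, so its slope vanishes; the h
       below contradicts a nonzero slope. *)
    - rewrite scaler0; apply: dot_eq0.
      apply/eqP/negPn/negP => w0.
      pose K := (qform es w - qform s' w - dot w w ^+ 2)%R.
      have := key w ((K + 1) * g / (2 * dot w w))%R.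
      set h := (_ / _)%R => hK.
      have E : (2 * (g * h) * dot w w = g ^+ 2 * (K + 1))%R.
        by rewrite /h; field.
      have := hK; rewrite sqrrD exprMn g2 in E *.
      by rewrite /K in E *; lra.
    - move=> y; rewrite qform_cons dot0l.
      have := key y 0%R; nra.
  have t2 : (0 < 1 - g ^+ 2)%R by rewrite subr_gt0 lt_neqAle g2.
  pose t := Num.sqrt (1 - g ^+ 2).
  have tE : (t ^+ 2 = 1 - g ^+ 2)%R by rewrite sqr_sqrtr// ltW.
  have t0 : (t != 0)%R by rewrite gt_eqF// sqrtr_gt0.
  exists (t^-1 *: w)%R, t; split; first by rewrite tE; ring.
    by rewrite scalerA divff// scale1r.
  move=> y; rewrite qform_cons dotZl.
  (* this h maximises the difference of the two sides of key *)
  have := key y (g * dot w y / t ^+ 2)%R.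
  suff -> : ((g * (g * dot w y / t ^+ 2) + dot w y) ^+ 2 =
    (t^-1 * dot w y) ^+ 2 + (g * dot w y / t ^+ 2) ^+ 2)%R.
    by rewrite addrAC [leRHS]addrC lerD2r.
  have -> : (g * (g * dot w y / t ^+ 2) + dot w y =
      dot w y * (g ^+ 2 + t ^+ 2) / t ^+ 2)%R.
    by field.
  have g2t : (g ^+ 2 = 1 - t ^+ 2)%R by rewrite tE; ring.
  transitivity (dot w y ^+ 2 * (g ^+ 2 + t ^+ 2) / t ^+ 4)%R; last by field.
  by rewrite g2t; field.
rewrite /= aE wE.
apply: (@le_trans _ _ (gauss_op e (gauss_ops (b :: s') F) v)).
  apply: gauss_op_le_split => //; first exact: borel_ge0_gauss_ops.
  exact: midconvex_gauss_ops.
apply: gauss_op_mono; [exact: borel_ge0_gauss_ops..|].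
exact: IH.
Qed.

End gauss_op.

(** * Linear images of the standard Gaussian vector *)

Section std_gaussian_image.
Context {R : realType} {p : nat}.
Local Open Scope ereal_scope.
Local Notation V := 'cV[R]_p.
Local Notation RR := (measurableTypeR R).
Implicit Types (F : V -> \bar R).

Definition col_tuple n (g : n.-tuple RR) : 'cV[R]_n := \col_(i < n) tnth g i.

Lemma measurable_comb F n (c : 'I_n -> V) v : borel_ge0 F ->
  measurable_fun [set: n.-tuple RR]
    (fun g : n.-tuple RR => F (v + \sum_i tnth g i *: c i)%R).
Proof.
move=> [mF _]; apply: (mF _ _ (fun g : n.-tuple RR => v + \sum_i tnth g i *: c i)%R) => j.
rewrite [X in measurable_fun _ X](_ : _ =
    (fun g : n.-tuple RR => v j ord0 + \sum_i tnth g i * c i j ord0)%R); last first.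
  apply/funext => g; rewrite mxE summxE; congr (_ + _)%R.
  by apply: eq_bigr => i _; rewrite mxE.
apply: measurable_funD => //; apply: measurable_sum => i.
apply: measurable_funM => //; exact: measurable_tnth.
Qed.

(** The standard Gaussian law is an iterated product of normal laws, so Tonelli's
    theorem integrates the coordinates out one after the other. *)
Lemma integral_std_gaussian_comb F n (c : 'I_n -> V) v : borel_ge0 F ->
  \int[std_gaussian R n]_g F (v + \sum_i tnth g i *: c i)%R =
  gauss_ops [seq c i | i <- enum 'I_n] F v.
Proof.
move=> bF; have [_ F0] := bF.
elim: n c v => [|n IH] c v.
  rewrite /= integral_dirac//.
    by rewrite diracT mul1e big_ord0 addr0 enum_ord0.
  exact: measurable_comb.
rewrite enum_ordSl/= -map_comp /gauss_op.
rewrite ge0_integral_distribution//; last exact: measurable_comb.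
rewrite fubini_tonelli1; first last.
- by move=> z; exact: F0.
- exact: measurableT_comp (measurable_comb c v bF) (@measurable_cons_pair R n).
apply: eq_integral => t _; rewrite /fubini_F -IH.
apply: eq_integral => g _ /=; rewrite big_ord_recl addrA; congr F; congr (_ + _)%R.
by apply: eq_bigr => i _; rewrite tnthS.
Qed.

End std_gaussian_image.

Section contraction.
Context {R : realType}.
Local Open Scope ereal_scope.

Lemma mulmx_col_tuple n (M : nat) (A : 'M[R]_(M, n)) (g : n.-tuple (measurableTypeR R)) :
  (A *m col_tuple g = 0 + \sum_i tnth g i *: col i A)%R.
Proof.
apply/colP => j; rewrite add0r mxE summxE; apply: eq_bigr => i _.
by rewrite !mxE mulrC.
Qed.

Lemma integral_std_gaussian_mulmx n p (M : 'M[R]_(p, n)) (F : 'cV[R]_p -> \bar R) :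
  borel_ge0 F ->
  \int[std_gaussian R n]_g F (M *m col_tuple g) = gauss_ops [seq col i M | i <- enum 'I_n] F 0%R.
Proof.
move=> bF; rewrite -integral_std_gaussian_comb//.
by apply: eq_integral => g _; rewrite mulmx_col_tuple.
Qed.

Lemma qform_cols n p (M : 'M[R]_(p, n)) y :
  qform [seq col i M | i <- enum 'I_n] y = dot (M^T *m y) (M^T *m y).
Proof.
rewrite /qform big_map big_enum; apply: eq_bigr => i _ /=.
rewrite -expr2; congr (_ ^+ 2)%R; rewrite mxE; apply: eq_bigr => j _.
by rewrite !mxE.
Qed.

Lemma orthonormal_delta (p : nat) :
  is_orthonormal [seq col i (1%:M : 'M[R]_p) | i <- enum 'I_p].
Proof.
have dotE (i j : 'I_p) : dot (col i 1%:M) (col j 1%:M) = ((i == j)%:R : R)%R.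
  rewrite /dot (bigD1 i)//= big1 => [|l li].
    by rewrite !mxE eqxx mul1r addr0.
  by rewrite !mxE (negbTE li) mul0r.
elim: (enum 'I_p) (enum_uniq 'I_p) => //= i s IH /andP[si us]; split.
- by rewrite dotE eqxx.
- move=> _ /mapP[j js ->]; rewrite dotE; case: eqVneq => // ji.
  by rewrite -ji js in si.
- exact: IH.
Qed.

(** A matrix whose transpose is a contraction sends the standard Gaussian vector
    to one whose covariance is at most the identity. *)
Theorem std_gaussian_contraction n p (M : 'M[R]_(p, n)) (F : 'cV[R]_p -> \bar R) :
  borel_ge0 F -> midconvex F ->
  (forall y, dot (M^T *m y) (M^T *m y) <= dot y y)%R ->
  \int[std_gaussian R n]_g F (M *m col_tuple g) <= \int[std_gaussian R p]_g F (col_tuple g).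
Proof.
move=> bF cF hM.
under [X in _ <= X]eq_integral do rewrite -[col_tuple _]mul1mx.
rewrite !integral_std_gaussian_mulmx//; apply: gauss_ops_dominated => //.
  exact: orthonormal_delta.
by move=> y; rewrite !qform_cols trmx1 mul1mx.
Qed.

End contraction.

(** * The Euclidean norm and nearest points *)

Section enorm_theory.
Context {R : realType} {k : nat}.
Implicit Types (x y z : 'cV[R]_k) (a : R).

Lemma enormE x : enorm x = Num.sqrt (dot x x).
Proof. by congr Num.sqrt; apply: eq_bigr => i _; rewrite expr2. Qed.

Lemma enorm_ge0 x : 0 <= enorm x. Proof. exact: sqrtr_ge0. Qed.

Lemma sqr_enorm x : enorm x ^+ 2 = dot x x.
Proof. by rewrite enormE sqr_sqrtr// dot_ge0. Qed.

Lemma enorm0_eq0 x : enorm x = 0 -> x = 0.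
Proof. by move=> x0; apply: dot_eq0; rewrite -sqr_enorm x0 expr0n. Qed.

Lemma enorm0 : enorm (0 : 'cV[R]_k) = 0.
Proof. by rewrite enormE dot0l sqrtr0. Qed.

Lemma enormZ a x : enorm (a *: x) = `|a| * enorm x.
Proof. by rewrite !enormE dotZl dotZr mulrA -expr2 sqrtrM ?sqr_ge0// sqrtr_sqr. Qed.

Lemma enormN x : enorm (- x) = enorm x.
Proof. by rewrite -scaleN1r enormZ normrN1 mul1r. Qed.

Lemma enorm_le_sqr x b : 0 <= b -> dot x x <= b ^+ 2 -> enorm x <= b.
Proof. by move=> b0 xb; rewrite -ler_sqr ?nnegrE ?enorm_ge0// sqr_enorm. Qed.

Lemma cauchy_schwarz x y : dot x y <= enorm x * enorm y.
Proof.
have [y0|y0] := eqVneq (enorm y) 0.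
  by rewrite (enorm0_eq0 y0) dot0r enorm0 mulr0.
apply: (le_trans (ler_norm _)).
rewrite -ler_sqr ?nnegrE ?mulr_ge0 ?enorm_ge0// real_normK ?num_real//.
rewrite exprMn !sqr_enorm.
have yy : 0 < dot y y by rewrite -sqr_enorm exprn_gt0// lt_neqAle eq_sym y0 enorm_ge0.
have := dot_ge0 (dot y y *: x - dot x y *: y).
have -> : dot (dot y y *: x - dot x y *: y) (dot y y *: x - dot x y *: y) =
    dot y y * (dot x x * dot y y - dot x y ^+ 2).
  by rewrite !(dotBl, dotBr, dotZl, dotZr) (dotC y x); ring.
by rewrite pmulr_rge0// subr_ge0.
Qed.

Lemma enormD x y : enorm (x + y) <= enorm x + enorm y.
Proof.
apply: enorm_le_sqr; first by rewrite addr_ge0 ?enorm_ge0.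
rewrite sqrrD !sqr_enorm !(dotDl, dotDr) (dotC y x).
by have := cauchy_schwarz x y; lra.
Qed.

Lemma enorm_distC x y : enorm (x - y) = enorm (y - x).
Proof. by rewrite -enormN opprB. Qed.

Lemma ler_enorm_dist x y : `|enorm x - enorm y| <= enorm (x - y).
Proof.
have := enormD (x - y) y; have := enormD (y - x) x.
rewrite !subrK (enorm_distC y) => h1 h2.
by rewrite ler_norml; apply/andP; split; lra.
Qed.

Lemma coord_le_enorm x i : `|x i ord0| <= enorm x.
Proof.
rewrite -ler_sqr ?nnegrE ?enorm_ge0// real_normK ?num_real// sqr_enorm.
rewrite /dot (bigD1 i)//= -expr2 lerDl sumr_ge0// => j _.
by rewrite -expr2 sqr_ge0.
Qed.

Lemma enorm_le_coord x e : (forall i, `|x i ord0| <= e) -> enorm x <= k%:R * e.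
Proof.
move=> xe; have [k0|k0] := posnP k.
  rewrite enormE /dot big1 ?sqrtr0 ?k0 ?mul0r// => i _.
  by have := ltn_ord i; rewrite [X in (_ < X)%N]k0.
have e0 : 0 <= e by rewrite (le_trans _ (xe (Ordinal k0))).
apply: enorm_le_sqr; first by rewrite mulr_ge0.
have -> : (k%:R * e) ^+ 2 = \sum_(i < k) (k%:R * e ^+ 2) :> R.
  by rewrite sumr_const card_ord -mulr_natl; ring.
apply: ler_sum => i _.
rewrite -expr2 -real_normK ?num_real//.
apply: (@le_trans _ _ (e ^+ 2)); first by rewrite ler_sqr ?nnegrE.
by rewrite ler_peMl ?sqr_ge0// ler1n.
Qed.

(** The topology of column vectors is that of the sup-norm; this inclusion and
    coord_le_enorm make it the Euclidean one. *)
Lemma enorm_near x e : 0 < e -> \forall y \near x, enorm (x - y) < e.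
Proof.
move=> e0; have k1 : 0 < k.+1%:R :> R by rewrite ltr0n.
apply/nbhs_ballP; exists (e / k.+1%:R) => /=; first by rewrite divr_gt0.
move=> y [_ xy].
apply: (@le_lt_trans _ _ (k%:R * (e / k.+1%:R))).
  by apply: enorm_le_coord => i; rewrite !mxE; apply/ltW/xy.
by rewrite mulrCA gtr_pMr// ltr_pdivrMr// mul1r ltr_nat.
Qed.

Lemma enorm_continuous x : continuous (fun y => enorm (x - y)).
Proof.
move=> y B /nbhs_ballP[e /= e0 eB].
have /nbhs_ballP[d /= d0 dB] := enorm_near y e0.
apply/nbhs_ballP; exists d => //= z /dB yz; apply: eB.
rewrite /ball/=; apply: le_lt_trans yz; apply: (le_trans (ler_enorm_dist _ _)).
by rewrite opprB addrC addrA subrK enorm_distC.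
Qed.

Lemma closureP (A : set 'cV[R]_k) x :
  closure A x <-> forall e, 0 < e -> exists2 a, A a & enorm (x - a) < e.
Proof.
split=> [clA e e0|H B].
  by have [a [Aa xa]] := clA _ (enorm_near x e0); exists a.
move=> /nbhs_ballP[e /= e0 eB].
have [a Aa xa] := H e e0; exists a; split => //; apply: eB; split=> // i j.
rewrite ord1; apply: le_lt_trans xa.
by have := coord_le_enorm (x - a) i; rewrite !mxE.
Qed.

(** A nearest point is a minimum of the distance over the compact part of K in a
    ball; the transpositions serve to apply the compactness of bounded closed sets
    of row vectors. *)
Lemma proj_spec (K : set 'cV[R]_k) x : closed K -> K !=set0 ->
  K (proj K x) /\ forall z, K z -> enorm (x - proj K x) <= enorm (x - z).
Proof.
move=> cK [z0 Kz0].
suff [y yP] : exists y, K y /\ forall z, K z -> enorm (x - y) <= enorm (x - z).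
  rewrite /proj; case: xgetP => [p _ []//|/(_ y)]; exact.
have tc : continuous (trmx : 'rV[R]_k -> 'cV[R]_k).
  move=> v B /nbhs_ballP[e /= e0 eB]; apply/nbhs_ballP; exists e => //= w [_ vw].
  by apply: eB; split => // i j; rewrite !mxE.
pose f (v : 'rV[R]_k) := enorm (x - v^T).
have fc : continuous f.
  move=> v; exact: (@continuous_comp _ _ _ trmx (fun y => enorm (x - y)) v
    (tc v) (@enorm_continuous x _)).
pose A := [set v : 'rV[R]_k | K v^T] `&` [set v | f v <= enorm (x - z0)].
have Acl : closed A.
  apply: closedI; first exact: (closed_comp (fun _ _ => tc _) cK).
  have := @closed_comp _ _ f [set r | r <= enorm (x - z0)] (fun v _ => fc v)
    (@closed_le R _).
  exact.
have Ab : bounded_set A.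
  exists (enorm (x - z0) + enorm x); split; first exact: num_real.
  move=> M ltM v [_ fv]; apply: le_trans (ltW ltM).
  rewrite [leLHS]/Num.norm /= mx_normrE; apply/bigmax_leP; split.
    by rewrite addr_ge0 ?enorm_ge0.
  move=> [i j] _ /=; rewrite ord1.
  have := coord_le_enorm v^T j; rewrite mxE => /le_trans; apply.
  have -> : v^T = - (x - v^T) + x by rewrite opprB subrK.
  by apply: (le_trans (enormD _ _)); rewrite enormN lerD2r.
have A0 : A !=set0 by exists z0^T; split; rewrite /= ?/f trmxK.
have [|v vA vmin] := compact_EVT_min A0 (bounded_closed_compact Ab Acl) (f := f).
  exact: continuous_subspaceT.
have [Kv fv] := set_mem vA.
exists v^T; split => // z Kz.
have [zle|/ltW zge] := leP (enorm (x - z)) (enorm (x - z0)).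
  have := vmin z^T; rewrite /f trmxK; apply.
  by apply/mem_set; split; rewrite /= ?/f trmxK.
exact: le_trans fv zge.
Qed.

End enorm_theory.

(** * Projection onto a closed convex cone *)

Section cones.
Context {R : realType}.

(** Stability under addition replaces convexity, to which it is equivalent for
    cones. *)
Definition closed_cone k (K : set 'cV[R]_k) :=
  [/\ closed K, K 0, forall x y, K x -> K y -> K (x + y)
    & forall (a : R) x, 0 <= a -> K x -> K (a *: x)].

Lemma closed_convex_cone_closed_cone k (K : set 'cV[R]_k) :
  closed_convex_cone K -> closed_cone K.
Proof.
move=> [clK [x0 Kx0] cK sK]; split => //; first by rewrite -(scale0r x0); exact: sK.
move=> x y Kx Ky.
have h0 : 0 <= 2^-1 :> R by rewrite invr_ge0.
have h1 : 2^-1 <= 1 :> R by rewrite invf_le1// ler1n.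
have := cK x y (Itv01 h0 h1) (mem_set Kx) (mem_set Ky).
move=> /set_mem/(sK 2 _ (ler0n _ _)); congr K.
transitivity (2 *: (2^-1 *: x + (1 - 2^-1) *: y) : 'cV[R]_k); first by [].
by apply/colP => i; rewrite !mxE; field.
Qed.

Section closure_image.
Variables (n p : nat) (A : 'M[R]_(p, n)) (C : set 'cV[R]_n).

Lemma closed_cone_closure_image : closed_cone C ->
  closed_cone (closure (mulmx A @` C)).
Proof.
move=> [clC C0 CD CZ]; split.
- exact: closed_closure.
- by apply: subset_closure; exists 0 => //; rewrite mulmx0.
- move=> x y /closureP Kx /closureP Ky; apply/closureP => e e0.
  have e2 : 0 < e / 2 by rewrite divr_gt0.
  have [_ [a Ca <-] xa] := Kx _ e2; have [_ [b Cb <-] yb] := Ky _ e2.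
  exists (A *m a + A *m b); first by exists (a + b); [exact: CD|rewrite mulmxDr].
  rewrite opprD addrACA; apply: (le_lt_trans (enormD _ _)); lra.
- move=> a x a0 /closureP Kx; apply/closureP => e e0.
  have a1 : 0 < a + 1 by rewrite ltr_wpDl.
  have [_ [b Cb <-] xb] := Kx (e / (a + 1)) (divr_gt0 e0 a1).
  exists (a *: (A *m b)); first by exists (a *: b); [exact: CZ|rewrite scalemxAr].
  rewrite -scalerBr enormZ ger0_norm//.
  rewrite ltr_pdivlMr// in xb.
  by have := enorm_ge0 (x - A *m b); nra.
Qed.

End closure_image.

Section projection.
Variables (k : nat) (K : set 'cV[R]_k).
Hypothesis cK : closed_cone K.
Local Notation h x := (enorm (proj K x)).

Let projP x : K (proj K x) /\ forall z, K z -> enorm (x - proj K x) <= enorm (x - z).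
Proof. by case: cK => clK K0 _ _; apply: proj_spec => //; exists 0. Qed.

Lemma proj_in x : K (proj K x). Proof. by case: (projP x). Qed.

Let proj_var x z : (forall t : R, 0 < t <= 1 -> K (proj K x + t *: z)) ->
  dot (x - proj K x) z <= 0.
Proof.
move=> Kt; set p := proj K x; rewrite leNgt; apply/negP => d0.
pose d := dot (x - p) z; pose m := dot z z.
have m0 : 0 <= m := dot_ge0 z.
pose t := d / (d + m + 1).
have D0 : 0 < d + m + 1 by rewrite /d; lra.
have t0 : 0 < t by rewrite divr_gt0.
have t1 : t <= 1 by rewrite ler_pdivrMr// mul1r; lra.
have tE : t * (d + m + 1) = d by rewrite divfK// gt_eqF.
have := (projP x).2 _ (Kt t _); rewrite t0 t1 => /(_ isT).
rewrite -ler_sqr ?nnegrE ?enorm_ge0// !sqr_enorm -/p opprD addrA.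
rewrite [leRHS](_ : _ = dot (x - p) (x - p) - t * (2 * d - t * m)).
  by rewrite lerDl oppr_ge0 leNgt => /negP; apply; rewrite mulr_gt0//; nra.
rewrite !(dotBl _ (t *: z), dotBr _ _ (t *: z)) !(dotZl, dotZr).
by rewrite (dotC z (x - p)) -/d -/m; ring.
Qed.

(** With p the projection of x, first-order optimality in the directions p and
    - p says that x - p is orthogonal to p. *)
Lemma dot_proj x : dot x (proj K x) = h x ^+ 2.
Proof.
have [clK K0 KD KZ] := cK; have Kp := proj_in x.
rewrite sqr_enorm; apply/eqP; rewrite -subr_eq0 -dotBl eq_le; apply/andP; split.
  apply: proj_var => t /andP[t0 _]; rewrite -[X in X + _]scale1r -scalerDl.
  by apply: KZ => //; lra.
rewrite -oppr_le0 -dotNr; apply: proj_var => t /andP[t0 t1].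
by rewrite scalerN -[X in X - _]scale1r -scalerBl; apply: KZ => //; rewrite subr_ge0.
Qed.

(** Together with proj_norm_le this makes the norm of the projection the supremum
    of dot x z over the z of K in the unit ball; the properties of the projection
    used below all come from these two lemmas. *)
Lemma dot_le_proj_norm x z : K z -> dot x z <= h x * enorm z.
Proof.
have [clK K0 KD KZ] := cK => Kz.
apply: le_trans (cauchy_schwarz _ _); rewrite -subr_le0 -dotBl.
apply: proj_var => t /andP[/ltW t0 _].
by apply: KD; [exact: proj_in|exact: KZ].
Qed.

Lemma proj_norm_le x (c : R) : 0 <= c -> (forall z, K z -> dot x z <= c * enorm z) -> h x <= c.
Proof.
move=> c0 /(_ _ (proj_in x)); rewrite dot_proj expr2.
have [->//|h0] := eqVneq (h x) 0.
by rewrite ler_pM2r// lt_neqAle eq_sym h0 enorm_ge0.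
Qed.

Lemma proj_norm_lip x y : h x <= h y + enorm (x - y).
Proof.
apply: proj_norm_le => [|z Kz]; first by rewrite addr_ge0 ?enorm_ge0.
rewrite mulrDl -[x in dot x z](subrK y) addrC dotDl lerD ?cauchy_schwarz//.
exact: dot_le_proj_norm.
Qed.

Lemma proj_norm_midconvex x y : 2 * h x <= h (x + y) + h (x - y).
Proof.
rewrite mulrC -ler_pdivlMr//; apply: proj_norm_le => [|z Kz].
  by rewrite divr_ge0// addr_ge0 ?enorm_ge0.
have := dot_le_proj_norm (x + y) Kz; have := dot_le_proj_norm (x - y) Kz.
rewrite !dotDl dotNl; nra.
Qed.

Lemma proj_normZ_le (a : R) x : 0 <= a -> h (a *: x) <= a * h x.
Proof.
move=> a0; apply: proj_norm_le => [|z Kz]; first by rewrite mulr_ge0 ?enorm_ge0.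
by rewrite dotZl -mulrA ler_wpM2l// dot_le_proj_norm.
Qed.

Definition sqproj x : \bar R := (h x ^+ 2)%:E.

Lemma midconvex_sqproj : midconvex sqproj.
Proof.
move=> v y; rewrite /sqproj -!EFinD lee_fin.
have := proj_norm_midconvex v y.
have := enorm_ge0 (proj K v); have := enorm_ge0 (proj K (v + y)).
have := enorm_ge0 (proj K (v - y)).
set a := h v; set b := h (v - y); set c := h (v + y) => b0 c0 a0 mid.
have : 0 <= (c + b - 2 * a) * (c + b + 2 * a) by apply: mulr_ge0; lra.
by have := sqr_ge0 (b - c); nra.
Qed.

End projection.

(** The value f x is below a exactly when f q + enorm (x - q) is below a for
    some rational vector q, which makes the sublevel sets countable unions of
    measurable ones. *)
Lemma borel_lipschitz k (f : 'cV[R]_k -> R) :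
  (forall x y, f x <= f y + enorm (x - y)) ->
  forall d (T : measurableType d) (phi : T -> 'cV[R]_k),
  coord_measurable phi -> measurable_fun [set: T] (f \o phi).
Proof.
move=> lf d T phi mphi mT; apply: (measurability _ (RGenInftyO.measurableE R)) => //.
move=> /= _ [_ [a ->] <-]; rewrite setTI.
pose q2v (q : 'cV[rat]_k) : 'cV[R]_k := map_mx ratr q.
rewrite [X in measurable X](_ : _ = \bigcup_(q : 'cV[rat]_k)
    ([set t | f (q2v q) + enorm (phi t - q2v q) < a])).
  apply: countable_bigcupT_measurable; first exact: countableP.
  move=> q.
  have mE : measurable_fun [set: T] (fun t => f (q2v q) + enorm (phi t - q2v q)).
    apply: measurable_funD => //.
    apply: (measurableT_comp (continuous_measurable_fun (@sqrt_continuous R))).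
    apply: measurable_sum => i; apply: measurable_funX.
    rewrite [X in measurable_fun _ X](_ : _ = (fun t => phi t i ord0 - q2v q i ord0)).
      by apply: measurable_funB.
    by apply/funext => t; rewrite !mxE.
  have := mE measurableT _ (measurable_itv `]-oo, a[).
  by rewrite setTI; congr measurable; apply/seteqP; split => t /=; rewrite in_itv.
apply/seteqP; split => t /=; rewrite in_itv/=; last first.
  by move=> [q _] /=; apply: le_lt_trans; exact: lf.
move=> fa.
(* f q + enorm (phi t - q) will exceed f (phi t) by at most 2 e *)
pose e := (a - f (phi t)) / 3.
have e0 : 0 < e by rewrite divr_gt0// subr_gt0.
have k1 : 0 < k.+1%:R :> R by rewrite ltr0n.
pose e' := e / k.+1%:R.
have e'0 : 0 < e' by rewrite divr_gt0.
have [q qP] : exists q : 'I_k -> rat, forall i, `|phi t i ord0 - ratr (q i)| <= e'.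
  suff /choice[q qP] : forall i : 'I_k, exists r : rat, `|phi t i ord0 - ratr r| <= e'.
    by exists q.
  move=> i.
  have /rat_in_itvoo[r] : phi t i ord0 - e' < phi t i ord0 + e' by lra.
  rewrite in_itv/= => /andP[r1 r2]; exists r.
  by rewrite ler_norml; apply/andP; split; lra.
have pq : enorm (phi t - q2v (\col_i q i)) <= e.
  apply: (@le_trans _ _ (k%:R * e')).
    by apply: enorm_le_coord => i; rewrite !mxE.
  by rewrite /e' mulrCA ger_pMr// ler_pdivrMr// mul1r ler_nat.
exists (\col_i q i) => //=.
apply: (@le_lt_trans _ _ (f (phi t) + e + e)).
  rewrite lerD//; apply: (le_trans (lf _ (phi t))).
  by rewrite lerD2l enorm_distC.
by rewrite /e; lra.
Qed.

Lemma borel_sqproj k (K : set 'cV[R]_k) : closed_cone K -> borel_ge0 (sqproj K).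
Proof.
move=> cK; split=> [d T phi mphi|v]; last by rewrite lee_fin sqr_ge0.
apply/measurable_EFinP; apply: measurable_funX.
apply: (borel_lipschitz (f := fun x => enorm (proj K x)) _ mphi) => x y.
exact: proj_norm_lip.
Qed.

End cones.

(** * Comparison of statistical dimensions *)

Section statdim_theory.
Context {R : realType}.
Local Open Scope ereal_scope.

Lemma dot_mulmxl n p (M : 'M[R]_(p, n)) x y : dot (M *m x) y = dot x (M^T *m y).
Proof.
have dotE k (u v : 'cV[R]_k) : dot u v = ((u^T *m v) ord0 ord0)%R.
  by rewrite mxE; apply: eq_bigr => i _; rewrite mxE.
by rewrite !dotE trmx_mul mulmxA.
Qed.

Lemma statdimE k (K : set 'cV[R]_k) :
  statdim K = \int[std_gaussian R k]_g sqproj (closure K) (col_tuple g).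
Proof. by rewrite /statdim unlock. Qed.

Lemma statdim_ge0 k (K : set 'cV[R]_k) : 0 <= statdim K.
Proof. by rewrite statdimE integral_ge0// => g _; rewrite lee_fin sqr_ge0. Qed.

Lemma measurable_mulmx_col_tuple n p (M : 'M[R]_(p, n)) (F : 'cV[R]_p -> \bar R) :
  borel_ge0 F -> measurable_fun [set: n.-tuple (measurableTypeR R)]
    (fun g : n.-tuple (measurableTypeR R) => F (M *m col_tuple g)%R).
Proof.
move=> bF; have := measurable_comb (fun i => col i M) 0%R bF.
by congr measurable_fun; apply/funext => g; rewrite mulmx_col_tuple.
Qed.

Lemma sqproj_le k l (K : set 'cV[R]_k) (J : set 'cV[R]_l) (c : R) x y : (0 <= c)%R ->
  (enorm (proj K x) <= c * enorm (proj J y))%R ->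
  sqproj K x <= (c ^+ 2)%:E * sqproj J y.
Proof.
move=> c0 xy; rewrite /sqproj -EFinM lee_fin -exprMn.
by rewrite ler_sqr// nnegrE ?mulr_ge0 ?enorm_ge0.
Qed.

(** The squared norm of the projection is convex and homogeneous of degree 2, so
    that a matrix of norm L reduces to a contraction. *)
Lemma integral_sqproj_mulmx_le n p (M : 'M[R]_(p, n)) (K : set 'cV[R]_p) (L : R) :
  closed_cone K -> (0 <= L)%R -> (forall y, enorm (M^T *m y) <= L * enorm y)%R ->
  \int[std_gaussian R n]_g sqproj K (M *m col_tuple g) <=
  (L ^+ 2)%:E * \int[std_gaussian R p]_g sqproj K (col_tuple g).
Proof.
move=> cK; have bK := borel_sqproj cK.
rewrite le_eqVlt => /predU1P[<- hM|L0 hM].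
  rewrite expr0n mul0e integral0_eq// => g _.
  apply/eqP; rewrite eqe sqrf_eq0 eq_le enorm_ge0 andbT.
  apply: proj_norm_le => // z _; rewrite dot_mulmxl.
  by rewrite (@enorm0_eq0 _ _ (M^T *m z)%R) ?dot0r ?mul0r//; apply/eqP;
    rewrite eq_le enorm_ge0 andbT -[leRHS](mul0r (enorm z)).
have M'E : M = (L *: (L^-1 *: M))%R by rewrite scalerA divff ?scale1r// gt_eqF.
set M' := (L^-1 *: M)%R in M'E.
have hM' y : (dot (M'^T *m y) (M'^T *m y) <= dot y y)%R.
  rewrite -!sqr_enorm ler_sqr ?nnegrE ?enorm_ge0//.
  rewrite /M' linearZ/= -scalemxAl enormZ ger0_norm ?invr_ge0 ?(ltW L0)//.
  by rewrite ler_pdivrMl.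
apply: (@le_trans _ _ ((L ^+ 2)%:E * \int[std_gaussian R n]_g sqproj K (M' *m col_tuple g))).
  rewrite -ge0_integralZl//; last 3 first.
  - exact: measurable_mulmx_col_tuple.
  - by move=> g _; case: bK.
  - by rewrite lee_fin sqr_ge0.
  apply: ge0_le_integral => //.
  - by move=> g _; case: bK.
  - exact: measurable_mulmx_col_tuple.
  - by apply: measurable_funeM; exact: measurable_mulmx_col_tuple.
  move=> g _; rewrite M'E -scalemxAl; apply: sqproj_le; first exact: ltW.
  by apply: proj_normZ_le => //; exact: ltW.
rewrite lee_pmul2l ?lte_fin ?exprn_gt0//.
by apply: std_gaussian_contraction => //; exact: midconvex_sqproj.
Qed.

(** A pointwise comparison with the projection onto K of a linear image of the
    Gaussian vector suffices to compare the statistical dimensions; both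
    inequalities of the theorem are instances of it. *)
Lemma statdim_transfer n p (M : 'M[R]_(p, n)) (K : set 'cV[R]_p) (J : set 'cV[R]_n)
    (L c : R) :
  closed_cone (closure K) -> closed_cone (closure J) -> (0 <= L)%R -> (0 <= c)%R ->
  (forall y, enorm (M^T *m y) <= L * enorm y)%R ->
  (forall g, enorm (proj (closure J) g) <= c * enorm (proj (closure K) (M *m g)))%R ->
  statdim J <= ((L * c) ^+ 2)%:E * statdim K.
Proof.
move=> cK cJ L0 c0 hM hJ; rewrite !statdimE.
have bK := borel_sqproj cK; have bJ := borel_sqproj cJ.
rewrite exprMn mulrC EFinM -muleA.
apply: (@le_trans _ _ ((c ^+ 2)%:E *
    \int[std_gaussian R n]_g sqproj (closure K) (M *m col_tuple g))).
  rewrite -ge0_integralZl//; last 3 first.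
  - exact: measurable_mulmx_col_tuple.
  - by move=> g _; case: bK.
  - by rewrite lee_fin sqr_ge0.
  apply: ge0_le_integral => //.
  - by move=> g _; case: bJ.
  - have := measurable_mulmx_col_tuple 1%:M bJ.
    by congr measurable_fun; apply/funext => g; rewrite mul1mx.
  - by apply: measurable_funeM; exact: measurable_mulmx_col_tuple.
  by move=> g _; apply: sqproj_le.
apply: lee_wpmul2l; first by rewrite lee_fin sqr_ge0.
exact: integral_sqproj_mulmx_le.
Qed.

Lemma statdim_trivial k (K : set 'cV[R]_k) : (forall x, K x -> x = 0%R) -> statdim K = 0.
Proof.
move=> K0; rewrite statdimE integral0_eq// => g _.
rewrite /sqproj.
have clK0 z : closure K z -> z = 0%R.
  move=> /closureP Kz; apply: enorm0_eq0; apply/eqP; rewrite eq_le enorm_ge0 andbT.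
  apply/ler_addgt0Pr => e e0; have [a /K0 -> za] := Kz e e0.
  by rewrite add0r; move: za; rewrite subr0 => /ltW.
rewrite /proj; case: xgetP => [p _ [/clK0 -> _]|_]; by rewrite enorm0 expr0n.
Qed.

(** The integrand is bounded below by a positive constant on [1, 2]. *)
Lemma integral_normal_sqr_gt0 : 0 < \int[@normal_prob R 0 1]_t (t ^+ 2)%:E.
Proof.
have m2 : measurable_fun [set: measurableTypeR R] (fun t : R => (t ^+ 2)%:E).
  by apply/measurable_EFinP; exact: measurable_funX.
rewrite ge0_integral_normal_prob//; last by move=> t; rewrite lee_fin sqr_ge0.
have mphi : measurable_fun [set: measurableTypeR R] (fun t : R => (normal_pdf 0 1 t)%:E).
  by apply/measurable_EFinP; exact: measurable_normal_pdf.
apply: (@lt_le_trans _ _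
  (\int[lebesgue_measure]_(t in `[1%R, 2%R]) (normal_pdf (0:R) 1 2)%:E)).
  rewrite integral_cst//= lebesgue_measure_itv/= lte_fin ltr1n -EFinD -EFinM lte_fin.
  apply: mulr_gt0; last by lra.
  by rewrite normal_pdf_std mulr_gt0 ?expR_gt0// normal_peak_gt0 ?oner_eq0.
apply: (@le_trans _ _ (\int[lebesgue_measure]_(t in `[1%R, 2%R])
    ((t ^+ 2)%:E * (normal_pdf (0:R) 1 t)%:E))).
  apply: ge0_le_integral => //.
  - by move=> t _; rewrite lee_fin normal_pdf_ge0.
  - by apply: measurable_funTS; exact: emeasurable_funM.
  move=> t /=; rewrite in_itv/= => /andP[t1 t2].
  rewrite -EFinM lee_fin !normal_pdf_std.
  have P0 : (0 <= normal_peak (1 : R))%R by exact: normal_peak_ge0.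
  apply: (@le_trans _ _ (normal_peak 1 * expR (- t ^+ 2 / 2))%R).
    by apply: ler_wpM2l => //; rewrite ler_expR; nra.
  by rewrite ler_peMl ?mulr_ge0 ?expR_ge0//; nra.
apply: ge0_subset_integral => //.
- exact: emeasurable_funM.
- by move=> t _; rewrite -EFinM lee_fin mulr_ge0 ?sqr_ge0 ?normal_pdf_ge0.
Qed.

(** A unit vector u of K is a one-column matrix whose transpose is a contraction,
    so the statistical dimension is at least the expectation of the squared norm of
    the projection of g u, with g standard normal.  The values at g and - g add up to at
    least g^2. *)
Lemma statdim_gt0 k (K : set 'cV[R]_k) x : closed_cone K -> K x -> x <> 0%R ->
  0 < statdim K.
Proof.
move=> cK Kx x0; have [clK K0 KD KZ] := cK.
have nx0 : (0 < enorm x)%R.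
  by rewrite lt_neqAle enorm_ge0 andbT; apply/eqP => /esym/enorm0_eq0.
have [u [Ku nu]] : exists u, K u /\ enorm u = 1%R.
  exists ((enorm x)^-1 *: x)%R; split; first by apply: KZ => //; rewrite invr_ge0 enorm_ge0.
  by rewrite enormZ ger0_norm ?invr_ge0 ?enorm_ge0// mulVf// gt_eqF.
rewrite statdimE -(closure_id K).1//.
have bK := borel_sqproj cK; have [_ F0] := bK.
apply: (@lt_le_trans _ _ (\int[std_gaussian R 1]_g sqproj K (u *m col_tuple g))); last first.
  apply: std_gaussian_contraction => //; first exact: midconvex_sqproj.
  move=> y; rewrite [X in (X <= _)%R](_ : _ = dot u y ^+ 2)%R.
    have := cauchy_schwarz u y; have := cauchy_schwarz u (- y)%R.
    rewrite enormN dotNr nu mul1r -sqr_enorm => h1 h2.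
    rewrite -ler_sqrt ?sqr_ge0// !sqrtr_sqr [leRHS]ger0_norm ?enorm_ge0//.
    by rewrite ler_norml; apply/andP; split; lra.
  rewrite {1}/dot big_ord1 expr2; congr (_ * _)%R; rewrite mxE;
    by apply: eq_bigr => i _; rewrite mxE.
rewrite integral_std_gaussian_mulmx//.
rewrite [X in gauss_ops X](_ : _ = [:: u]); last first.
  rewrite enum_ordSl enum_ord0 /=; congr (_ :: _).
  by apply/colP => i; rewrite mxE.
rewrite /= lt0e; apply/andP; split; last by case: (borel_ge0_gauss_op u bK).
apply/eqP => I0.
have := integral_normal_sqr_gt0; rewrite ltNge => /negP; apply.
have -> : 0 = gauss_op u (sqproj K) 0%R + gauss_op (- u) (sqproj K) 0%R.
  by rewrite (gauss_opN u bK) I0 adde0.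
rewrite -ge0_integralD//; [|exact: measurable_gauss_line..].
apply: ge0_le_integral => //.
- by move=> t _; rewrite lee_fin sqr_ge0.
- by apply/measurable_EFinP; exact: measurable_funX.
- by apply: emeasurable_funD; exact: measurable_gauss_line.
move=> t _; rewrite !add0r /sqproj -EFinD lee_fin.
have := dot_le_proj_norm cK (t *: u)%R Ku; have := dot_le_proj_norm cK (t *: - u)%R Ku.
rewrite !(dotZl, dotNl) -sqr_enorm nu expr1n !mulr1 mulrN1.
have := enorm_ge0 (proj K (t *: u)%R); have := enorm_ge0 (proj K (t *: - u)%R).
by case: (lerP 0 t) => t0; nra.
Qed.

End statdim_theory.

(** * Condition numbers and the image of a cone *)

Section condition_numbers.
Context {R : realType}.

Lemma opnormP n p (A : 'M[R]_(p, n)) : exists L : R,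
  [/\ opnorm A = L%:E, 0 <= L & forall x, enorm (A *m x) <= L * enorm x].
Proof.
pose B := p%:R * (\sum_i \sum_j `|A i j|).
have ub x : enorm x <= 1 -> enorm (A *m x) <= B.
  move=> x1; apply: enorm_le_coord => i; rewrite mxE.
  apply: (le_trans (ler_norm_sum _ _ _)).
  apply: (@le_trans _ _ (\sum_j `|A i j|)).
    apply: ler_sum => j _; rewrite normrM ler_piMr//.
    exact: le_trans (coord_le_enorm x j) x1.
  rewrite [leRHS](bigD1 i)//= lerDl sumr_ge0// => l _.
  by apply: sumr_ge0 => j _.
have inO x : enorm x <= 1 -> ((enorm (A *m x))%:E <= opnorm A)%E.
  by move=> x1; apply: ereal_sup_ubound; exists x.
have O0 : (0 <= opnorm A)%E.
  by have := inO 0; rewrite mulmx0 !enorm0; apply; exact: ler01.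
have OB : (opnorm A <= B%:E)%E.
  by apply: ge_ereal_sup => _ [x x1 <-]; rewrite lee_fin; exact: ub.
have Ofin : opnorm A \is a fin_num.
  by rewrite ge0_fin_numE// (le_lt_trans OB)// ltry.
exists (fine (opnorm A)); split; first by rewrite fineK.
  by rewrite fine_ge0.
move=> x; have [x0|x0] := eqVneq (enorm x) 0.
  by rewrite (enorm0_eq0 x0) mulmx0 !enorm0 mulr0.
have xp : 0 < enorm x by rewrite lt_neqAle eq_sym x0 enorm_ge0.
have := inO ((enorm x)^-1 *: x).
rewrite enormZ ger0_norm ?invr_ge0 ?enorm_ge0// mulVf// => /(_ (lexx _)).
rewrite -scalemxAr enormZ ger0_norm ?invr_ge0 ?enorm_ge0//.
by rewrite -[opnorm A]fineK// lee_fin mulrC ler_pdivrMr.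
Qed.

(** Both sigma_cone and sigma_to_cone are infima of this form, and sigma is the
    case where C is the whole space. *)
Lemma inf_sphereP k (C : set 'cV[R]_k) (N : 'cV[R]_k -> R) :
  (forall (a : R) x, 0 <= a -> C x -> C (a *: x)) ->
  (forall x, 0 <= N x) -> (forall a x, 0 <= a -> N (a *: x) <= a * N x) ->
  let S := ereal_inf [set (N x)%:E | x in C `&` usphere R k] in
  (S = +oo%E /\ forall x, C x -> x = 0) \/
  (exists s, [/\ S = s%:E, 0 <= s & forall x, C x -> s * enorm x <= N x]).
Proof.
move=> CZ N0 NZ S.
have unit x : C x -> x <> 0 -> 0 < enorm x /\ (C `&` usphere R k) ((enorm x)^-1 *: x).
  move=> Cx x0.
  have nx0 : (0 < enorm x)%R.
    by rewrite lt_neqAle enorm_ge0 andbT; apply/eqP => /esym/enorm0_eq0.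
  split => //; split; first by apply: CZ => //; rewrite invr_ge0 enorm_ge0.
  by rewrite /usphere /= enormZ ger0_norm ?invr_ge0 ?enorm_ge0// mulVf// gt_eqF.
have S0 : (0 <= S)%E by apply: le_ereal_inf_tmp => _ [x _ <-]; rewrite lee_fin.
have [Sy|Sy] := eqVneq S +oo%E.
  left; split=> // x Cx; apply: contrapT => x0; have [_ ux] := unit x Cx x0.
  have : (S <= (N ((enorm x)^-1 *: x))%:E)%E.
    by apply: ereal_inf_lbound; exists ((enorm x)^-1 *: x).
  by rewrite Sy leye_eq.
right; have Sfin : S \is a fin_num by rewrite ge0_fin_numE// ltey.
exists (fine S); split; [by rewrite fineK|by rewrite fine_ge0|move=> x Cx].
have [->|/eqP x0] := eqVneq x 0; first by rewrite enorm0 mulr0.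
have [nx0 ux] := unit x Cx x0.
rewrite -ler_pdivlMr//.
have : (S <= (N ((enorm x)^-1 *: x))%:E)%E.
  by apply: ereal_inf_lbound; exists ((enorm x)^-1 *: x).
rewrite -[S]fineK// lee_fin => /le_trans; apply.
by rewrite mulrC; apply: NZ; rewrite invr_ge0 enorm_ge0.
Qed.

Lemma quot_fin (L s : R) : 0 < s -> quot L%:E s%:E = (L / s)%:E.
Proof. by move=> s0; rewrite /quot eqe gt_eqF// inver gt_eqF. Qed.

Lemma quot0 (a : \bar R) : quot a 0%:E = +oo%E.
Proof. by rewrite /quot eqxx. Qed.

Section upper.
Variables (n p : nat) (A : 'M[R]_(p, n)) (C : set 'cV[R]_n) (s : R).
Hypotheses (cC : closed_cone C) (s0 : 0 < s).

Let clCE : closure C = C.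
Proof. by case: cC => clC _ _ _; rewrite -(closure_id C).1. Qed.

(** For y = A x with x in C, dot g y = dot (A^T g) x is at most the norm of
    the projection of A^T g times that of x, and the latter is at most
    enorm y / s.  The general z of the closure is approximated by such y. *)
Lemma proj_image_le_sigma g : (forall x, C x -> s * enorm x <= enorm (A *m x)) ->
  enorm (proj (closure (mulmx A @` C)) g) <= s^-1 * enorm (proj C (A^T *m g)).
Proof.
move=> sA; have cD := closed_cone_closure_image A cC.
pose c := s^-1 * enorm (proj C (A^T *m g)); rewrite -/c.
have c0 : 0 <= c by rewrite /c mulr_ge0 ?enorm_ge0// invr_ge0 ltW.
apply: proj_norm_le => // z /closureP Kz.
apply/ler_addgt0Pr => e e0.
(* both errors, in dot g and in c * enorm, are proportional to the distance
   from z to A x *)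
pose m := enorm g + c + 1.
have m0 : 0 < m by have := enorm_ge0 g; rewrite /m; lra.
have [_ [x Cx <-] zx] := Kz _ (divr_gt0 e0 m0).
have h1 : dot g (A *m x) <= c * enorm (A *m x).
  rewrite dotC dot_mulmxl dotC; apply: (le_trans (dot_le_proj_norm cC _ Cx)).
  rewrite /c -mulrA mulrCA ler_wpM2l ?enorm_ge0// ler_pdivlMl//.
  exact: sA.
have h2 : dot g (z - A *m x) <= enorm g * enorm (z - A *m x) by exact: cauchy_schwarz.
have h3 : enorm (A *m x) <= enorm z + enorm (z - A *m x).
  by rewrite enorm_distC -[X in enorm X <= _](subrK z) addrC enormD.
have h4 : enorm (z - A *m x) * m <= e by rewrite -ler_pdivlMr// ltW.
rewrite -[X in dot g X](subrK (A *m x)) dotDr.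
have := enorm_ge0 (z - A *m x); rewrite /m in h4; nra.
Qed.

(** The projection of g is no longer than g itself, to which the hypothesis
    applies with y = - g. *)
Lemma proj_image_le_sigma_to g : (forall y, s * enorm y <= enorm (proj C (- A^T *m y))) ->
  enorm (proj (closure (mulmx A @` C)) g) <= s^-1 * enorm (proj C (A^T *m g)).
Proof.
move=> sA; have cD := closed_cone_closure_image A cC.
apply: (proj_norm_le cD) => [|z Kz]; first by rewrite mulr_ge0 ?enorm_ge0// invr_ge0 ltW.
apply: (le_trans (cauchy_schwarz _ _)); rewrite ler_wpM2r ?enorm_ge0// ler_pdivlMl//.
by have := sA (- g); rewrite enormN mulmxN mulNmx opprK.
Qed.

Lemma statdim_image_le (L : R) : 0 <= L -> (forall x, enorm (A *m x) <= L * enorm x) ->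
  (forall g, enorm (proj (closure (mulmx A @` C)) g) <= s^-1 * enorm (proj C (A^T *m g))) ->
  (statdim (mulmx A @` C) <= ((L / s) ^+ 2)%:E * statdim C)%E.
Proof.
move=> L0 AL H; apply: (statdim_transfer (M := A^T)) => //.
- by rewrite clCE.
- exact: closed_cone_closure_image.
- by rewrite invr_ge0 ltW.
- by move=> y; rewrite trmxK.
- by rewrite clCE.
Qed.

End upper.

(** The Moore-Penrose inverse (A^T A)^-1 A^T, whose product with A on the left is
    an orthogonal projection. *)
Lemma left_inverse_bound n p (A : 'M[R]_(p, n)) (s : R) : 0 < s ->
  (forall x, s * enorm x <= enorm (A *m x)) ->
  exists B : 'M[R]_(n, p), B *m A = 1%:M /\ forall y, enorm (B *m y) <= s^-1 * enorm y.
Proof.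
move=> s0 sA; pose G := A^T *m A.
have inj (x : 'cV[R]_n) : A *m x = 0 -> x = 0.
  move=> Ax; apply: enorm0_eq0; apply/eqP; rewrite eq_le enorm_ge0 andbT.
  by have := sA x; rewrite Ax enorm0 pmulr_rle0.
have Gu : G \in unitmx.
  rewrite -row_free_unit; apply: inj_row_free => v vG.
  have : A *m v^T = 0.
    apply: dot_eq0; rewrite dot_mulmxl mulmxA -/G.
    have -> : G *m v^T = (v *m G)^T by rewrite trmx_mul [G^T]trmx_mul trmxK.
    by rewrite vG trmx0 dot0r.
  by move=> /inj /(congr1 trmx); rewrite trmxK trmx0.
exists (invmx G *m A^T); split; first by rewrite -mulmxA mulVmx.
move=> y; set x := _ *m y.
rewrite ler_pdivlMl//; apply: (le_trans (sA x)).
have : enorm (A *m x) ^+ 2 <= enorm (A *m x) * enorm y.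
  have Gx : G *m x = A^T *m y by rewrite /x !mulmxA mulmxV// mul1mx.
  by rewrite sqr_enorm dot_mulmxl mulmxA -/G Gx -dot_mulmxl cauchy_schwarz.
have [->|n0] := eqVneq (enorm (A *m x)) 0; first by rewrite enorm_ge0.
by rewrite expr2 ler_pM2l// lt_neqAle eq_sym n0 enorm_ge0.
Qed.

(** With B a left inverse of A, the support function of C at g is that of the
    image at B^T g up to the factor L, because dot g z = dot (B^T g) (A z). *)
Lemma statdim_le_image n p (A : 'M[R]_(p, n)) (C : set 'cV[R]_n) (L s : R) :
  closed_cone C -> 0 < s -> 0 <= L ->
  (forall x, s * enorm x <= enorm (A *m x)) ->
  (forall x, enorm (A *m x) <= L * enorm x) ->
  (statdim C <= ((L / s) ^+ 2)%:E * statdim (mulmx A @` C))%E.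
Proof.
move=> cC s0 L0 sA AL; have [B [BA Bs]] := left_inverse_bound s0 sA.
have [clC _ _ _] := cC.
have cD := closed_cone_closure_image A cC.
rewrite mulrC; apply: (statdim_transfer (M := B^T)) => //.
- by rewrite -(closure_id C).1.
- by rewrite invr_ge0 ltW.
- by move=> y; rewrite trmxK.
move=> g; rewrite -(closure_id C).1//.
apply: proj_norm_le => // [|z Cz]; first by rewrite mulr_ge0 ?enorm_ge0.
rewrite -[X in dot g X](mul1mx z) -BA -mulmxA dotC dot_mulmxl dotC.
apply: (@le_trans _ _
  (enorm (proj (closure (mulmx A @` C)) (B^T *m g)) * enorm (A *m z))).
  by apply: dot_le_proj_norm => //; apply: subset_closure; exists z.
by rewrite mulrAC [leRHS]mulrC ler_wpM2l ?enorm_ge0.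
Qed.

(** The hypothesis makes A^T injective, so that A is square and A^T is onto.
    Writing x = A^T w gives |x|^2 = dot (A x) w, with t |w| at most |x|. *)
Lemma lower_bound_trmx n p (A : 'M[R]_(p, n)) (t : R) : 0 < t -> (n <= p)%N ->
  (forall y, t * enorm y <= enorm (A^T *m y)) ->
  forall x, t * enorm x <= enorm (A *m x).
Proof.
move=> t0 np tA x.
have fA : row_free A.
  apply: inj_row_free => v vA.
  have : v^T = 0.
    apply: enorm0_eq0; apply/eqP; rewrite eq_le enorm_ge0 andbT.
    by have := tA v^T; rewrite -trmx_mul vA trmx0 enorm0 pmulr_rle0.
  by move=> /(congr1 trmx); rewrite trmxK trmx0.
have rA : row_full A.
  by rewrite /row_full eqn_leq rank_leq_col; move: fA; rewrite /row_free => /eqP ->.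
have /submxP[w xw] : (x^T <= A)%MS by exact: submx_full.
have {}xw : x = A^T *m w^T by rewrite -trmx_mul -xw trmxK.
have tw := tA w^T; rewrite -xw in tw.
have [x0|x0] := eqVneq (enorm x) 0; first by rewrite x0 mulr0 enorm_ge0.
have xp : 0 < enorm x by rewrite lt_neqAle eq_sym x0 enorm_ge0.
have h : enorm x ^+ 2 <= enorm (A *m x) * enorm w^T.
  by rewrite sqr_enorm {2}xw -dot_mulmxl cauchy_schwarz.
have := enorm_ge0 (A *m x); have := enorm_ge0 w^T.
rewrite -(ler_pM2r xp); nra.
Qed.

End condition_numbers.

(** * The bounds on the statistical dimension of an image *)

Section bounds.
Context {R : realType}.
Local Open Scope ereal_scope.

Lemma statdim_image_trivial n p (A : 'M[R]_(p, n)) (C : set 'cV[R]_n) :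
  (forall x, C x -> x = 0%R) -> statdim (mulmx A @` C) = 0.
Proof. by move=> C0; apply: statdim_trivial => _ [x /C0 -> <-]; rewrite mulmx0. Qed.

(** In the extended reals the product of +oo and 0 is 0: the bound by an infinite
    condition number has content when the statistical dimension of C vanishes,
    which happens only for the trivial cone. *)
Lemma statdim_image_ley n p (A : 'M[R]_(p, n)) (C : set 'cV[R]_n) : closed_cone C ->
  statdim (mulmx A @` C) <= +oo ^+ 2 * statdim C.
Proof.
move=> cC; have [C0|/existsNP[x /not_implyP[Cx x0]]] := pselect (forall x, C x -> x = 0%R).
  by rewrite statdim_image_trivial// mule_ge0 ?statdim_ge0// expe_ge0.
by rewrite expe2 mulyy gt0_mulye ?leey//; exact: (statdim_gt0 cC Cx).
Qed.

Lemma cV0_eq0 p (y : 'cV[R]_p) : p = 0%N -> y = 0%R.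
Proof. by move=> p0; apply/colP => i; have := ltn_ord i; rewrite [X in (_ < X)%N]p0. Qed.

Theorem statdim_image_renegar n p (A : 'M[R]_(p, n)) (C : set 'cV[R]_n) : closed_cone C ->
  statdim (mulmx A @` C) <= renegar C A ^+ 2 * statdim C.
Proof.
move=> cC; have [clC C0 CD CZ] := cC.
have [L [OE L0 AL]] := opnormP A.
rewrite /renegar OE minEle; case: ifP => _.
- have N0 x : (0 <= enorm (A *m x))%R by exact: enorm_ge0.
  have NZ (a : R) x : (0 <= a -> enorm (A *m (a *: x)) <= a * enorm (A *m x))%R.
    by move=> a0; rewrite -scalemxAr enormZ ger0_norm.
  have [[SE Cx]|[s [SE s0 sA]]] := inf_sphereP CZ N0 NZ.
    by rewrite statdim_image_trivial// mule_ge0 ?statdim_ge0// expe_ge0// /sigma_cone SE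
      /quot /= invey mule0.
  rewrite /sigma_cone SE; move: s0; rewrite le_eqVlt => /predU1P[<-|s0].
    by rewrite quot0; exact: statdim_image_ley.
  rewrite quot_fin// -EFin_expe; apply: statdim_image_le => // g.
  exact: proj_image_le_sigma.
- have N0 y : (0 <= enorm (proj C (- A^T *m y)))%R by exact: enorm_ge0.
  have NZ (a : R) y :
      (0 <= a -> enorm (proj C (- A^T *m (a *: y))) <= a * enorm (proj C (- A^T *m y)))%R.
    by move=> a0; rewrite -scalemxAr; exact: proj_normZ_le.
  have := @inf_sphereP R p setT _ (fun _ _ _ _ => Logic.I) N0 NZ.
  rewrite setTI => -[[SE yT]|[s [SE s0 sA]]].
    rewrite (@statdim_trivial _ _ (mulmx A @` C)) => [|x _]; last exact: yT.
    by rewrite mule_ge0 ?statdim_ge0// expe_ge0// /sigma_to_cone SE /quot /= invey mule0.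
  rewrite /sigma_to_cone SE; move: s0; rewrite le_eqVlt => /predU1P[<-|s0].
    by rewrite quot0; exact: statdim_image_ley.
  rewrite quot_fin// -EFin_expe; apply: statdim_image_le => // g.
  by apply: proj_image_le_sigma_to => // y; exact: sA.
Qed.

Lemma sigmaP n p (A : 'M[R]_(p, n)) : (0 < n)%N -> exists s : R,
  [/\ sigma A = s%:E, (0 <= s)%R & forall x, (s * enorm x <= enorm (A *m x))%R].
Proof.
move=> n0; have N0 x : (0 <= enorm (A *m x))%R by exact: enorm_ge0.
have NZ (a : R) x : (0 <= a -> enorm (A *m (a *: x)) <= a * enorm (A *m x))%R.
  by move=> a0; rewrite -scalemxAr enormZ ger0_norm.
have := @inf_sphereP R n setT _ (fun _ _ _ _ => Logic.I) N0 NZ.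
rewrite setTI => -[[_ xT]|[s [SE s0 sA]]].
- have := xT (const_mx 1%R) Logic.I => /colP/(_ (Ordinal n0)).
  by rewrite !mxE => /eqP; rewrite oner_eq0.
- by exists s; split => // x; exact: sA.
Qed.

(** A finite second term in the definition of kappa bounds A, and not only its
    transpose, from below, since n is at most p. *)
Lemma kappaP n p (A : 'M[R]_(p, n)) : (0 < n)%N -> (n <= p)%N ->
  kappa A = +oo \/ exists L s : R, [/\ kappa A = (L / s)%:E, (0 < s)%R, (0 <= L)%R,
    forall x, (enorm (A *m x) <= L * enorm x)%R
  & forall x, (s * enorm x <= enorm (A *m x))%R].
Proof.
move=> n0 np; have [L [OE L0 AL]] := opnormP A.
rewrite /kappa OE minEle; case: ifP => _.
- have [s [SE s0 sA]] := sigmaP A n0.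
  rewrite SE; move: s0; rewrite le_eqVlt => /predU1P[<-|s0]; first by left; exact: quot0.
  by right; exists L, s; split => //; exact: quot_fin.
- have [s [SE s0 sA]] := sigmaP A^T (leq_trans n0 np).
  rewrite SE; move: s0; rewrite le_eqVlt => /predU1P[<-|s0]; first by left; exact: quot0.
  right; exists L, s; split => //; first exact: quot_fin.
  exact: lower_bound_trmx.
Qed.

Theorem statdim_image_kappa n p (A : 'M[R]_(p, n)) (C : set 'cV[R]_n) : closed_cone C ->
  (n <= p)%N ->
  statdim C / kappa A ^+ 2 <= statdim (mulmx A @` C) /\
  statdim (mulmx A @` C) <= kappa A ^+ 2 * statdim C.
Proof.
move=> cC np; have [n0|n0] := posnP n.
  have C0 x : C x -> x = 0%R by move=> _; exact: cV0_eq0.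
  by rewrite (statdim_trivial C0) (statdim_image_trivial _ C0) mul0e mule0.
have [->|[L [s [-> s0 L0 AL sA]]]] := kappaP A n0 np.
  split; last exact: statdim_image_ley.
  by rewrite expe2 mulyy invey mule0 statdim_ge0.
have Ls : (0 < L / s)%R.
  rewrite divr_gt0// (lt_le_trans s0)//.
  have e0 : (0 < enorm (const_mx 1 : 'cV[R]_n))%R.
    rewrite lt_neqAle enorm_ge0 andbT; apply/eqP => /esym/enorm0_eq0/colP/(_ (Ordinal n0)).
    by rewrite !mxE => /eqP; rewrite oner_eq0.
  by rewrite -(ler_pM2r e0); exact: le_trans (sA _) (AL _).
rewrite -EFin_expe; split.
  rewrite inver gt_eqF ?exprn_gt0// lee_pdivrMr ?exprn_gt0// muleC.
  exact: statdim_le_image.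
by apply: statdim_image_le => // g; apply: proj_image_le_sigma => // x _; exact: sA.
Qed.

End bounds.

Theorem theorem1 (R : realType) (n : nat) (C : set 'cV[R]_n)
    (hC : closed_convex_cone C) (p : nat) (A : 'M[R]_(p, n)) :
  (statdim (mulmx A @` C) <= renegar C A ^+ 2 * statdim C)%E /\
  ((n <= p)%N -> \rank A = minn p n ->
   (statdim C / kappa A ^+ 2 <= statdim (mulmx A @` C))%E /\
   (statdim (mulmx A @` C) <= kappa A ^+ 2 * statdim C)%E).
Proof.
have cC := closed_convex_cone_closed_cone hC.
split; first exact: statdim_image_renegar.
by move=> np _; exact: statdim_image_kappa.
Qed.
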